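(* Let $n=2$ and let the cost structure be separable. Then the optimal threshold $\theta_0^*$ of the optimal score floor mechanism is weakly increasing in the importance of private information $\alpha$, while the optimal threshold $\theta_0^*$ of the optimal score ceiling mechanism is weakly decreasing in $\alpha$. (Thus both mechanisms become more symmetric as $\alpha$ grows.)
   Context: Setting. Two firms have types $\theta_i\in[0,1]$, i.i.d. with cdf $F$ and strictly positive density $f$; $J(\theta)=\theta+F(\theta)/f(\theta)$ is strictly increasing. Separable cost structure: the buyer's value of quality is $V(q)=q$, the production cost is $C^P(q,\theta)=\alpha\theta$ with $\alpha>0$, the investment cost is $C^I(q,\theta)=g(q)$ with $g(0)=g'(0)=0$, $g'(q)>0$ and $g''(q)>0$ for $q>0$, and $g'(q)>1$ for all large $q$. The buyer's expected utility from outcome functions $(z_i(\bm\theta),q_i(\theta_i))_{i=1,2}$ is $U=\mathbb E\sum_{i=1}^2\big((q_i(\theta_i)-\alpha J(\theta_i))z_i(\bm\theta)-g(q_i(\theta_i))\big)$. Let $q^*_{sym}(\theta)=(g')^{-1}(1-F(\theta))$. The score floor mechanism with threshold $\theta_0\in[0,1]$ induces the right-censored outcomes: with $\tilde\theta_1=\min(\theta_0,\theta_1)$, $z_1=\mathbb I(\tilde\theta_1<\theta_2)$, $z_2=1-z_1$, $q_1(\theta_1)=q^*_{sym}(\tilde\theta_1)$, $q_2(\theta_2)=q^*_{sym}(\theta_2)$ if $\theta_2<\theta_0$ and $q_2(\theta_2)=q^*_{sym}(1)=0$ if $\theta_2>\theta_0$. The score ceiling mechanism with threshold $\theta_0\in[0,1]$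 induces the left-censored outcomes: with $\tilde\theta_2=\max(\theta_0,\theta_2)$, $z_2=\mathbb I(\tilde\theta_2<\theta_1)$, $z_1=1-z_2$, $q_2(\theta_2)=q^*_{sym}(\tilde\theta_2)$, $q_1(\theta_1)=q^*_{sym}(\theta_1)$ if $\theta_1>\theta_0$ and $q_1(\theta_1)=q^*_{sym}(0)$ if $\theta_1<\theta_0$. The optimal threshold $\theta_0^*=\theta_0^*(\alpha)$ of the optimal score floor (resp. score ceiling) mechanism is a maximizer over $\theta_0\in[0,1]$ of the buyer's expected utility $U$ from the score floor (resp. score ceiling) mechanism with threshold $\theta_0$. *)

(* Defs.v *)
From HB Require Import structures.
From mathcomp Require Import all_boot all_order all_algebra.
From mathcomp Require Import all_classical all_reals all_analysis.

Set Implicit Arguments.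
Unset Strict Implicit.
Unset Printing Implicit Defensive.

Import Order.TTheory GRing.Theory Num.Theory numFieldNormedType.Exports.

Local Open Scope classical_set_scope.
Local Open Scope ring_scope.

Section Types.
Context {d : measure_display} {T : measurableType d} {R : realType}.
Variable P : probability T R.

Definition independent_RV2 (X Y : {RV P >-> R}) : Prop :=
  forall A B : set R, measurable A -> measurable B ->
    P (X @^-1` A `&` Y @^-1` B) = (P (X @^-1` A) * P (Y @^-1` B))%E.

(* Lebesgue-density sense of "f is the density of F"; f need not be continuous,
   and J below uses the pointwise values of this particular version f. *)
Definition positive_density (F f : R -> R) : Prop :=
  [/\ measurable_fun (`[0, 1] : set R) f,
      forall x, x \in `[0, 1] -> 0 < f x
    & forall x, x \in `[0, 1] ->
        (F x)%:E = (\int[lebesgue_measure]_(y in `[0%R, x]) (f y)%:E)%E].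

Definition iid_types (F f : R -> R) (X1 X2 : {RV P >-> R}) : Prop :=
  [/\ forall w, (X1 w \in `[0, 1]) && (X2 w \in `[0, 1]),
      independent_RV2 X1 X2,
      forall x, cdf X1 x = (F x)%:E /\ cdf X2 x = (F x)%:E
    & positive_density F f].

End Types.

Section Model.
Context {R : realType}.
Implicit Types (F f g : R -> R) (t a x y q : R).

Definition virtual_cost F f x : R := x + F x / f x.

(* The quality domain is [0, +oo[, so the derivative at 0 is one-sided; the
   values of g on negative reals play no role. *)
Definition right_derive1 g x : R := lim (h^-1 * (g (x + h) - g x) @[h --> 0^'+]).

Definition marginal_cost g q : R :=
  if 0 < q then derive1 g q else right_derive1 g 0.

Definition investment_cost g : Prop :=
  [/\ g 0 = 0,
      h^-1 * (g (0 + h) - g 0) @[h --> 0^'+] --> (0 : R),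
      forall q : R, 0 < q ->
        [/\ derivable g q 1, 0 < derive1 g q,
            derivable (derive1 g) q 1 & 0 < derive1 (derive1 g) q]
    & \forall q \near +oo, 1 < derive1 g q].

(* (g')^{-1}, as the inverse of g' on [0, +oo[; the default value 0 is returned
   outside the range of g', which contains [0, 1] for an investment cost. *)
Definition inv_marginal_cost g : R -> R :=
  'pinv_(fun=> 0) `[0, +oo[ (marginal_cost g).

Definition qsym F g x : R := inv_marginal_cost g (1 - F x).

(* Allocations take the two types (of firm 1, of firm 2); qualities depend on
   the firm's own type only. *)
Record outcome := Outcome {
  alloc1 : R -> R -> R;
  alloc2 : R -> R -> R;
  quality1 : R -> R;
  quality2 : R -> R }.

(* At the cutoff type itself, where the outcome is specified only up to a null
   event, the censored value of the quality is used. *)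
Definition score_floor F g t : outcome :=
  let z1 x1 x2 := (Num.min t x1 < x2)%R%:R in
  {| alloc1 := z1;
     alloc2 := fun x1 x2 => 1 - z1 x1 x2;
     quality1 := fun x1 => qsym F g (Num.min t x1);
     quality2 := fun x2 => if x2 < t then qsym F g x2 else qsym F g 1 |}.

Definition score_ceiling F g t : outcome :=
  let z2 x1 x2 := (Num.max t x2 < x1)%R%:R in
  {| alloc1 := fun x1 x2 => 1 - z2 x1 x2;
     alloc2 := z2;
     quality1 := fun x1 => if t < x1 then qsym F g x1 else qsym F g 0;
     quality2 := fun x2 => qsym F g (Num.max t x2) |}.

(* Value q, production cost a * theta and investment cost g(q); the transfers
   have been replaced by information rents, which turns theta into the virtual
   cost J(theta). *)
Definition buyer_payoff F f g a (o : outcome) (x1 x2 : R) : R :=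
  ((quality1 o x1 - a * virtual_cost F f x1) * alloc1 o x1 x2
     - g (quality1 o x1))
+ ((quality2 o x2 - a * virtual_cost F f x2) * alloc2 o x1 x2
     - g (quality2 o x2)).

Definition buyer_utility {d : measure_display} {T : measurableType d}
    (P : probability T R) (X1 X2 : {RV P >-> R}) F f g a (o : outcome) : \bar R :=
  ('E_P[fun w => buyer_payoff F f g a o (X1 w) (X2 w)])%E.

Definition optimal_threshold (U : R -> \bar R) t : Prop :=
  t \in `[0, 1] /\ forall s, s \in `[0, 1] -> (U s <= U t)%E.

End Model.

(* Main.v *)
Require Import Defs.
From HB Require Import structures.
From mathcomp Require Import all_boot all_order all_algebra.
From mathcomp Require Import all_classical all_reals all_analysis.
From mathcomp Require Import measurable_realfun ring lra.

Import Order.TTheory GRing.Theory Num.Theory numFieldNormedType.Exports.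
Local Open Scope classical_set_scope.
Local Open Scope ring_scope.

(* The utility of either mechanism is S(t) - a * B(t), where B(t) is the
   expected virtual production cost of the firm that is selected and S(t) does
   not depend on a. Comparing the optimality of t at a with that of t' at
   a' > a gives (a' - a) * (B(t') - B(t)) <= 0. Now B is strictly decreasing in
   the threshold of a floor and strictly increasing in that of a ceiling: moving
   the threshold towards the symmetric mechanism only replaces a winner by a
   rival of lower virtual cost, and does so with positive probability because
   the types are independent with positive density. The remaining point is that
   all the expectations involved are finite, since both J and the qualities are
   bounded. *)

(** This serves both for [u = g] and for [u = derive1 g]. Working on the open half-line keeps away
    from 0, where only a one-sided derivative of [g] is given. *)
Lemma positive_derive_homo {R : realType} (u : R -> R) :
  (forall q, 0 < q -> derivable u q 1) ->
  (forall q, 0 < q -> 0 < derive1 u q) ->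
  forall x y, 0 < x -> x < y -> u x < u y.
Proof.
move=> du u'0 x y x0 xy; apply: (@gtr0_derive1_lt_cc _ u x y) => //.
- by move=> z; rewrite in_itv/= => /andP[xz _]; apply: du; exact: lt_trans xz.
- by move=> z; rewrite in_itv/= => /andP[xz _]; apply: u'0; exact: lt_trans xz.
- apply: derivable_within_continuous => z; rewrite in_itv/= => /andP[xz _].
  by apply: du; exact: lt_le_trans xz.
- by rewrite in_itv/= lexx ltW.
- by rewrite in_itv/= lexx ltW.
Qed.

(** * Inverse marginal cost and bounds on the investment cost *)

Section investment_cost.
Context {R : realType} (g : R -> R) (Hg : investment_cost g).

Let g0 : g 0 = 0. Proof. by case: Hg. Qed.

Let dg q : 0 < q -> derivable g q 1.
Proof. by case: Hg => _ _ + _ q0 => /(_ _ q0)[]. Qed.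

Let g'gt0 q : 0 < q -> 0 < derive1 g q.
Proof. by case: Hg => _ _ + _ q0 => /(_ _ q0)[]. Qed.

Let dg' q : 0 < q -> derivable (derive1 g) q 1.
Proof. by case: Hg => _ _ + _ q0 => /(_ _ q0)[]. Qed.

Let g''gt0 q : 0 < q -> 0 < derive1 (derive1 g) q.
Proof. by case: Hg => _ _ + _ q0 => /(_ _ q0)[]. Qed.

Lemma marginal_cost_gt0E q : 0 < q -> marginal_cost g q = derive1 g q.
Proof. by rewrite /marginal_cost => ->. Qed.

Lemma marginal_cost0 : marginal_cost g 0 = 0.
Proof.
rewrite /marginal_cost ltxx /right_derive1; apply/cvg_lim => //.
by case: Hg.
Qed.

(** At [x = 0] the marginal cost vanishes and it is positive afterwards. For [x > 0] both values are
    those of [derive1 g], whose derivative is positive. *)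
Lemma marginal_cost_lt x y : 0 <= x -> x < y ->
  marginal_cost g x < marginal_cost g y.
Proof.
rewrite le_eqVlt => /predU1P[<-|x0] xy.
  by rewrite marginal_cost0 marginal_cost_gt0E// g'gt0.
rewrite (marginal_cost_gt0E _ x0) (marginal_cost_gt0E _ (lt_trans x0 xy)).
exact: (@positive_derive_homo _ (derive1 g)).
Qed.

Lemma marginal_cost_inj : {in `[0, +oo[%classic &, injective (marginal_cost g)}.
Proof.
move=> x y; rewrite !inE/= !in_itv/= !andbT => x0 y0 e.
have [xy|yx|//] := ltgtP x y.
- by have := marginal_cost_lt _ _ x0 xy; rewrite e ltxx.
- by have := marginal_cost_lt _ _ y0 yx; rewrite e ltxx.
Qed.

(* These images are the superlevel sets of the inverse marginal cost, whence its
   measurability. *)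
Lemma marginal_cost_image_itv c : 0 <= c ->
  is_interval (marginal_cost g @` `]c, +oo[).
Proof.
move=> c0; apply/connected_intervalP.
(* On this half-line the marginal cost is [derive1 g], which is differentiable, hence continuous,
   and so sends connected sets to connected sets. *)
rewrite (_ : _ @` _ = derive1 g @` `]c, +oo[); last first.
  apply: eq_imagel => q /=; rewrite in_itv/= andbT => cq.
  by rewrite marginal_cost_gt0E// (le_lt_trans c0).
apply: connected_continuous_connected.
  by apply/connected_intervalP; exact: interval_is_interval.
apply: derivable_within_continuous => z; rewrite in_itv/= andbT => cz.
by apply: dg'; exact: le_lt_trans cz.
Qed.

(** The default value lets the sign, the bound and the measurability of the inverse be proved by
    cases on whether the argument lies in the range of the marginal cost. *)
Lemma inv_marginal_cost_out y : ~ (marginal_cost g @` `[0, +oo[) y ->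
  inv_marginal_cost g y = 0.
Proof.
move=> ny; rewrite /inv_marginal_cost /pinv_ splitV /=.
by rewrite oinv_surj; case: pselect.
Qed.

Lemma inv_marginal_costK q : 0 <= q -> inv_marginal_cost g (marginal_cost g q) = q.
Proof.
move=> q0; rewrite /inv_marginal_cost pinvKV//; first exact: marginal_cost_inj.
by rewrite inE/= in_itv/= q0.
Qed.

Lemma inv_marginal_cost_ge0 y : 0 <= inv_marginal_cost g y.
Proof.
have [[q /=]|/inv_marginal_cost_out->//] :=
  pselect ((marginal_cost g @` `[0, +oo[) y).
by rewrite in_itv/= andbT => q0 <-; rewrite inv_marginal_costK.
Qed.

Lemma inv_marginal_cost_bounded :
  exists2 M, 0 < M & forall y, y <= 1 -> inv_marginal_cost g y <= M.
Proof.
have [_ _ _ [M [Mreal HM]]] := Hg.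
(* Beyond [M] the derivative exceeds 1. The maximum and the shift make [N] positive and strictly
   larger than [M], so a quality above [N] has marginal cost above 1. *)
pose N := Num.max M 0 + 1.
have N0 : 0 < N by rewrite ltr_wpDl// le_max lexx orbT.
exists N => // y y1.
have [[q /=]|/inv_marginal_cost_out->] :=
  pselect ((marginal_cost g @` `[0, +oo[) y); last exact: ltW.
rewrite in_itv/= andbT => q0 qy; rewrite -qy inv_marginal_costK// leNgt.
apply/negP => Nq; move: y1; apply/negP; rewrite -ltNge -qy.
apply: lt_trans (marginal_cost_lt _ _ (ltW N0) Nq).
by rewrite marginal_cost_gt0E//; apply: HM; rewrite /N ltr_pwDr// le_max lexx.
Qed.

Lemma measurable_inv_marginal_cost : measurable_fun setT (inv_marginal_cost g).
Proof.
apply: (measurability (@RGenOInfty.G R)) => [|/= _ [_] [r] -> <-].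
  exact: RGenOInfty.measurableE.
rewrite setTI; have [r0|r0] := ltP r 0.
  rewrite (_ : _ @^-1` _ = setT)//; apply/seteqP; split => //= y _.
  by rewrite /preimage/= in_itv/= andbT (lt_le_trans r0)// inv_marginal_cost_ge0.
rewrite (_ : _ @^-1` _ = marginal_cost g @` `]r, +oo[).
  by apply: is_interval_measurable; exact: marginal_cost_image_itv.
apply/seteqP; split => y /=.
  rewrite in_itv/= andbT.
  (* The default value 0 does not exceed [r], so points outside the range do not enter the
     superlevel set. *)
  have [[q /=]|/inv_marginal_cost_out->] :=
    pselect ((marginal_cost g @` `[0, +oo[) y); last by rewrite ltNge r0.
  rewrite in_itv/= andbT => q0 <-; rewrite inv_marginal_costK// => rq.
  by exists q => //; rewrite /= in_itv/= rq.
move=> [q /=]; rewrite !in_itv/= !andbT => rq <-.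
by rewrite inv_marginal_costK// (le_trans r0)// ltW.
Qed.

(** The point 0 is split off, since differentiability gives continuity on the open half-line. *)
Lemma measurable_investment_cost : measurable_fun (`[0, +oo[ : set R) g.
Proof.
rewrite -(@setU1itv _ _ _ _ false)//; apply/measurable_funU => //; split.
  exact: measurable_fun_set1.
apply: open_continuous_measurable_fun => // q.
rewrite inE/= in_itv/= andbT => q0.
by apply: differentiable_continuous; rewrite -derivable1_diffP; exact: dg.
Qed.

(** Monotonicity on the positive reals gives [g q <= g M]. For the lower bound, [q] is compared with
    some [h < q] so small that the difference quotient at 0 is below 1 in absolute value: then
    [g q > g h >= - h >= -1]. *)
Lemma investment_cost_bounded M : 0 < M ->
  exists K, forall q, 0 <= q <= M -> `|g q| <= K.
Proof.
move=> M0; exists (1 + `|g M|) => q /andP[q0 qM].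
move: q0; rewrite le_eqVlt => /predU1P[<-|q0].
  by rewrite g0 normr0 addr_ge0.
have gM : g q <= g M.
  move: qM; rewrite le_eqVlt => /predU1P[->//|qM].
  by apply/ltW; exact: positive_derive_homo.
have [_ Hg'0 _ _] := Hg.
have : \forall h \near (0:R)^'+, `|h^-1 * (g (0 + h) - g 0)| < 1.
  by move/cvgr0Pnorm_lt: Hg'0; exact.
move=> H.
have [h [h0 hq h1 hg]] : exists h, [/\ 0 < h, h < q, h <= 1 &
    `|h^-1 * (g (0 + h) - g 0)| < 1].
  near (0:R)^'+ => h; exists h; split; last by near: h.
  - by [].
  - by near: h; exact: nbhs_right_lt.
  - by near: h; exact: nbhs_right_le.
have gh : -1 <= g h.
  move: hg; rewrite add0r g0 subr0 normrM normfV (gtr0_norm h0).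
  rewrite ltr_pdivrMl// mulr1 ltr_norml => /andP[+ _] => /ltW; apply: le_trans.
  by rewrite lerN2.
have ghq : g h < g q by exact: positive_derive_homo.
rewrite ler_norml; apply/andP; split; last first.
  by rewrite (le_trans gM)// (le_trans (ler_norm _))// lerDr.
rewrite opprD (le_trans _ (ltW ghq))// (le_trans _ gh)//.
by rewrite gerDl oppr_le0.
Unshelve. all: by end_near. Qed.

End investment_cost.

(** The increment [F y - F x] is the integral of [f] over []x, y]]. Were it zero, [f] would vanish
    almost everywhere there; as [f] is positive, []x, y]] would be a null set, although its measure
    is [y - x > 0]. *)
Lemma positive_density_lt {R : realType} (F f : R -> R) :
  positive_density F f ->
  forall x y, 0 <= x -> x < y -> y <= 1 -> F x < F y.
Proof.
move=> [mf f0 HF] x y x0 xy y1.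
have sub z : `]x, y]%classic z -> `[0, 1]%classic z.
  rewrite /= !in_itv/= => /andP[xz zy].
  by rewrite (le_trans x0 (ltW xz)) (le_trans zy).
have mfy : measurable_fun (`]x, y] : set R) (EFin \o f).
  by apply/measurable_EFinP; exact: measurable_funS mf.
have FE : ((F y)%:E = (F x)%:E + \int[lebesgue_measure]_(z in `]x, y]) (f z)%:E)%E.
  rewrite !HF ?in_itv/= ?x0 ?(le_trans (ltW xy))// ?(le_trans x0 (ltW xy))//.
  have -> : `[0, y]%classic = `[0, x] `|` `]x, y].
    by rewrite -itv_bndbnd_setU// bnd_simp ?ltW.
  rewrite ge0_integral_setU//.
  - apply/measurable_EFinP; apply: measurable_funS mf => // z [] /=;
      last exact: sub.
    rewrite !in_itv/= => /andP[-> zx].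
    by rewrite (le_trans zx)// (le_trans (ltW xy)).
  - move=> z zxy; rewrite lee_fin ltW// f0//.
    case: zxy => [|/sub//]; rewrite /= !in_itv/= => /andP[-> zx].
    by rewrite (le_trans zx)// (le_trans (ltW xy)).
  - apply/disj_setPS => z /= []; rewrite !in_itv/= => /andP[_ zx] /andP[xz _].
    by move: xz; rewrite ltNge zx.
have I0 : (0 <= \int[lebesgue_measure]_(z in `]x, y]) (f z)%:E)%E.
  by apply: integral_ge0 => z /sub z01; rewrite lee_fin ltW// f0.
rewrite -lte_fin FE lteDl//; rewrite lt_def I0 andbT.
apply/eqP => I_eq0.
have : (\int[lebesgue_measure]_(z in `]x, y]) `|(EFin \o f) z| = 0)%E.
  rewrite -[RHS]I_eq0; apply: eq_integral => z; rewrite inE => /sub z01.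
  by rewrite /= ger0_norm// ltW// f0.
move=> /(ae_eq_integral_abs lebesgue_measure (measurable_itv _) mfy)[N [mN N0 sN]].
have : (lebesgue_measure `]x, y]%classic <= lebesgue_measure N)%E.
  apply: le_measure; rewrite ?inE// => z zxy; apply: sN => /= /(_ zxy)[fz0].
  by have := f0 _ (sub _ zxy); rewrite fz0 ltxx.
by rewrite N0 lebesgue_measure_itv/= lte_fin xy -EFinB lee_fin subr_le0 leNgt xy.
Qed.

(** * Bounded measurable functions and strict comparison of integrals *)

Section bounded_measurable.
Context {d : measure_display} {T : measurableType d} {R : realType}.
Context (P : probability T R).

(** A class stable under sums, differences and products and contained in the integrable functions,
    so that integrability is checked on the building blocks only. *)
Definition bounded_measurable (h : T -> R) : Prop :=
  measurable_fun setT h /\ exists M, forall w, `|h w| <= M.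

Lemma bounded_measurableD (h k : T -> R) : bounded_measurable h ->
  bounded_measurable k -> bounded_measurable (fun w => h w + k w).
Proof.
move=> [mh [M hM]] [mk [N kN]]; split; first exact: measurable_funD.
by exists (M + N) => w; rewrite (le_trans (ler_normD _ _))// lerD.
Qed.

Lemma bounded_measurableM (h k : T -> R) : bounded_measurable h ->
  bounded_measurable k -> bounded_measurable (fun w => h w * k w).
Proof.
move=> [mh [M hM]] [mk [N kN]]; split; first exact: measurable_funM.
by exists (M * N) => w; rewrite normrM ler_pM.
Qed.

Lemma bounded_measurableB (h k : T -> R) : bounded_measurable h ->
  bounded_measurable k -> bounded_measurable (fun w => h w - k w).
Proof.
move=> [mh [M hM]] [mk [N kN]]; split; first exact: measurable_funB.
by exists (M + N) => w; rewrite (le_trans (ler_normB _ _))// lerD.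
Qed.

Lemma bounded_measurable_cst (a : R) : bounded_measurable (fun=> a).
Proof. by split=> //; exists `|a|. Qed.

Lemma bounded_measurable_bool (b : T -> bool) : measurable_fun setT b ->
  bounded_measurable (fun w => (b w)%:R).
Proof.
move=> mb; split; last by exists 1 => w; case: (b w); rewrite ?normr1// normr0.
rewrite (_ : (fun _ => _) = fun w => if b w then 1 else 0); last first.
  by apply/funext => w; case: (b w).
exact: measurable_fun_ifT.
Qed.

Lemma bounded_measurable_integrable (h : T -> R) :
  bounded_measurable h -> P.-integrable setT (EFin \o h).
Proof.
move=> [mh [M hM]]; apply: measurable_bounded_integrable => //.
  by rewrite (le_lt_trans (probability_le1 P _))// ltry.
by exists M; split; [exact: num_real|move=> x Mx w _ /=; exact: le_trans (ltW Mx)].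
Qed.

(** The difference [k - h] dominates [e] times the indicator of [E], and the integral of the latter
    is [e] times the positive probability of [E]. *)
Lemma lt_Rintegral (h k : T -> R) (e : R) (E : set T) :
  bounded_measurable h -> bounded_measurable k -> (forall w, h w <= k w) ->
  0 < e -> measurable E -> (0 < P E)%E -> (forall w, E w -> h w + e <= k w) ->
  \int[P]_w h w < \int[P]_w k w.
Proof.
move=> bh bk hk e0 mE PE0 hek.
have ih := bounded_measurable_integrable _ bh.
have ik := bounded_measurable_integrable _ bk.
have bE : bounded_measurable (\1_E : T -> R).
  split; first exact: measurable_indic.
  by exists 1 => w; rewrite indicE; case: (_ \in _); rewrite ?normr1// normr0.
have beE := bounded_measurableM _ _ (bounded_measurable_cst e) bE.
rewrite -subr_gt0 -RintegralB//.
apply: (@lt_le_trans _ _ (\int[P]_w (e * \1_E w))).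
  rewrite RintegralZl//; last exact: bounded_measurable_integrable.
  rewrite mulr_gt0// /Rintegral integral_indic// setIT fine_gt0// PE0/=.
  by rewrite (le_lt_trans (probability_le1 P _))// ltry.
apply: le_Rintegral => //.
- exact: bounded_measurable_integrable.
- by apply: bounded_measurable_integrable; exact: bounded_measurableB.
- move=> w _; rewrite indicE; case: (boolP (w \in E)) => wE.
    by rewrite mulr1 lerBrDl hek//; rewrite inE in wE.
  by rewrite mulr0 subr_ge0.
Qed.

End bounded_measurable.

(** A revealed preference argument: when the two optimality inequalities are added, the values of
    [A] cancel. *)
Lemma optimal_threshold_le {R : realType} (A B : R -> R) (U : R -> R -> \bar R)
    (a a' t t' : R) :
  (forall b s, U b s = (A s - b * B s)%:E) -> a < a' ->
  optimal_threshold (U a) t -> optimal_threshold (U a') t' -> B t' <= B t.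
Proof.
move=> UE aa' [t01 tmax] [t'01 t'max].
have := tmax _ t'01; have := t'max _ t01; rewrite !UE !lee_fin => H1 H2.
rewrite -subr_ge0 -(pmulr_rge0 _ (_ : 0 < a' - a)) ?subr_gt0//.
lra.
Qed.

(** * Distribution of the types and virtual cost *)

Section types.
Context {R : realType} {d : measure_display} {T : measurableType d}.
Context {P : probability T R} {X1 X2 : {RV P >-> R}} {F f : R -> R}.
Context (Htypes : iid_types F f X1 X2).

Lemma types_cdf_ge0 x : 0 <= F x.
Proof. by case: Htypes => _ _ /(_ x)[HF _] _; rewrite -lee_fin -HF cdf_ge0. Qed.

Lemma types_cdf_homo x y : x <= y -> F x <= F y.
Proof.
case: Htypes => _ _ HF _ xy; rewrite -lee_fin.
by have [<- _] := HF x; have [<- _] := HF y; exact: cdf_nondecreasing.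
Qed.

Lemma measurable_types_cdf : measurable_fun setT F.
Proof. exact: nondecreasing_measurable types_cdf_homo. Qed.

Lemma cdf_itv (X : {RV P >-> R}) : (forall x, cdf X x = (F x)%:E) ->
  forall x y, x <= y -> P (X @^-1` `]x, y]) = (F y - F x)%:E.
Proof.
move=> HF x y xy; rewrite EFinB -!HF /cdf /distribution/= /pushforward.
rewrite (_ : X @^-1` `]x, y] = X @^-1` `]-oo, y] `\` X @^-1` `]-oo, x]); last first.
  apply/seteqP; split => w /=; rewrite !in_itv/=.
    by move=> /andP[xw wy]; split=> //; apply/negP; rewrite -ltNge.
  by move=> [wy /negP]; rewrite -ltNge => xw; rewrite xw.
have mX z : measurable (X @^-1` `]-oo, z]).
  by rewrite -[X in measurable X]setTI; exact: measurable_funPT.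
rewrite measureD//.
  by rewrite setIidr// => w /=; rewrite !in_itv/= => wx; exact: le_trans xy.
by rewrite (le_lt_trans (probability_le1 P _))// ltry.
Qed.

(** Independence factors the probability into two increments of [F], each positive because [F] is
    strictly increasing on the unit interval. *)
Lemma types_split_gt0 s m1 m2 t : 0 <= s -> s < m1 -> m1 < m2 -> m2 < t ->
  t <= 1 -> (0 < P (X1 @^-1` `]m2, t] `&` X2 @^-1` `]s, m1]))%E.
Proof.
move=> s0 sm1 m12 m2t t1; have [_ indep HF dens] := Htypes.
have m10 := le_lt_trans s0 sm1; have m20 := lt_trans m10 m12.
rewrite indep//.
rewrite (cdf_itv X1) ?(cdf_itv X2) ?ltW//; last 2 first.
- by move=> x; case: (HF x).
- by move=> x; case: (HF x).
rewrite -EFinM lte_fin mulr_gt0// subr_gt0.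
  by apply: (positive_density_lt _ _ dens) => //; exact: ltW.
apply: (positive_density_lt _ _ dens) => //.
by rewrite (le_trans (ltW m12))// (le_trans (ltW m2t)).
Qed.

Section virtual_cost.
Context (HJ : {in `[0, 1] &, {homo virtual_cost F f : x y / x < y}}).
Local Notation J := (virtual_cost F f).

Lemma virtual_cost_le x y : x \in `[0, 1] -> y \in `[0, 1] ->
  x <= y -> J x <= J y.
Proof.
move=> x01 y01; rewrite le_eqVlt => /predU1P[->//|xy].
by apply/ltW; exact: HJ.
Qed.

Lemma bounded_measurable_virtual_cost (X : {RV P >-> R}) :
  (forall w, X w \in `[0, 1]) -> bounded_measurable (fun w => J (X w)).
Proof.
move=> X01'.
have i0 : (0 : R) \in `[0, 1] by rewrite in_itv/= lexx ler01.
have i1 : (1 : R) \in `[0, 1] by rewrite in_itv/= lexx ler01.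
(* [J] is monotone on the unit interval only. Composed with the projection onto it, [J] becomes
   nondecreasing on the whole line, hence measurable, and is unchanged along [X]. *)
pose clamp z : R := Num.max 0 (Num.min 1 z).
have clamp01 z : clamp z \in `[0, 1].
  by rewrite in_itv/= le_max lexx ge_max ler01 ge_min lexx.
have clampX w : clamp (X w) = X w.
  have := X01' w; rewrite in_itv/= => /andP[w0 w1].
  by rewrite /clamp (min_idPr w1) (max_idPr w0).
split.
  rewrite (_ : (fun _ => _) = (J \o clamp) \o X); last first.
    by apply/funext => w /=; rewrite clampX.
  apply: measurableT_comp => //; apply: nondecreasing_measurable => // x y xy.
  by apply: virtual_cost_le => //; rewrite /clamp le_max2// le_min2.
exists (`|J 0| + `|J 1|) => w.
have := X01' w; rewrite in_itv/= => /andP[w0 w1].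
have J0 := virtual_cost_le _ _ i0 (X01' w) w0.
have J1 := virtual_cost_le _ _ (X01' w) i1 w1.
have := ler_norm (J 1); have := ler_norm (- J 0); rewrite normrN => n0 n1.
have := normr_ge0 (J 0); have := normr_ge0 (J 1) => p1 p0.
by rewrite ler_norml; apply/andP; split; lra.
Qed.

End virtual_cost.
End types.

(** * Decomposition of the utility and comparison of selection costs *)

Section mechanism.
Context {R : realType} {d : measure_display} {T : measurableType d}.
Context {P : probability T R} {X1 X2 : {RV P >-> R}} {F f g : R -> R}.
Context (Htypes : iid_types F f X1 X2).
Context (HJ : {in `[0, 1] &, {homo virtual_cost F f : x y / x < y}}).
Context (Hg : investment_cost g).
Local Notation J := (virtual_cost F f).

Lemma bounded_measurable_qsym (Y : T -> R) : measurable_fun setT Y ->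
  bounded_measurable (fun w => qsym F g (Y w)).
Proof.
move=> mY; split.
  apply: (measurableT_comp (measurable_inv_marginal_cost _ Hg)).
  apply: measurable_funB => //.
  exact: measurableT_comp (measurable_types_cdf Htypes) mY.
have [M M0 HM] := inv_marginal_cost_bounded _ Hg.
exists M => w; rewrite ger0_norm; last exact: inv_marginal_cost_ge0.
by apply: HM; rewrite gerBl; exact: types_cdf_ge0 Htypes _.
Qed.

Lemma bounded_measurable_investment_cost (q : T -> R) : (forall w, 0 <= q w) ->
  bounded_measurable q -> bounded_measurable (fun w => g (q w)).
Proof.
move=> q0 [mq [M qM]]; split.
  have mgq := measurable_comp _ _ (measurable_investment_cost _ Hg) mq.
  by apply: mgq => // _ [w _ <-] /=; rewrite in_itv/= q0.
(* The bound on [g] is stated for intervals with a positive right end, hence the maximum with 1. *)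
have M0 : 0 < Num.max M 1 by rewrite lt_max ltr01 orbT.
have [K HK] := investment_cost_bounded _ Hg _ M0.
exists K => w; apply: HK; rewrite q0/= le_max; apply/orP; left.
exact: le_trans (ler_norm _) (qM w).
Qed.

(** What floors and ceilings share. Writing each quality as [qsym] at a censored type [Y] makes it
    nonnegative, bounded and measurable at once. *)
Definition regular_outcome (o : outcome) : Prop :=
  [/\ bounded_measurable (fun w => alloc1 o (X1 w) (X2 w)),
      bounded_measurable (fun w => alloc2 o (X1 w) (X2 w)),
      exists2 Y : T -> R, measurable_fun setT Y &
        forall w, quality1 o (X1 w) = qsym F g (Y w)
    & exists2 Y : T -> R, measurable_fun setT Y &
        forall w, quality2 o (X2 w) = qsym F g (Y w)].

(** This is the term S(t) of the decomposition; [expected_allocation_cost] is B(t). *)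
Definition expected_surplus (o : outcome) : R :=
  \int[P]_w (quality1 o (X1 w) * alloc1 o (X1 w) (X2 w) - g (quality1 o (X1 w))
    + (quality2 o (X2 w) * alloc2 o (X1 w) (X2 w) - g (quality2 o (X2 w)))).

Definition allocation_cost (o : outcome) (x1 x2 : R) : R :=
  J x1 * alloc1 o x1 x2 + J x2 * alloc2 o x1 x2.

Definition expected_allocation_cost (o : outcome) : R :=
  \int[P]_w allocation_cost o (X1 w) (X2 w).

Let bJ1 : bounded_measurable (fun w => J (X1 w)).
Proof.
apply: (bounded_measurable_virtual_cost HJ X1) => w.
by case: Htypes => /(_ w)/andP[].
Qed.

Let bJ2 : bounded_measurable (fun w => J (X2 w)).
Proof.
apply: (bounded_measurable_virtual_cost HJ X2) => w.
by case: Htypes => /(_ w)/andP[].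
Qed.

Lemma bounded_measurable_allocation_cost o : regular_outcome o ->
  bounded_measurable (fun w => allocation_cost o (X1 w) (X2 w)).
Proof.
by move=> [bz1 bz2 _ _]; apply: bounded_measurableD; exact: bounded_measurableM.
Qed.

(** The payoff splits pointwise and the expectation is linear. Boundedness makes the utility a real
    number, the form in which optimality at two values of [a] is compared. *)
Lemma buyer_utilityE a o : regular_outcome o ->
  buyer_utility X1 X2 F f g a o =
  (expected_surplus o - a * expected_allocation_cost o)%:E.
Proof.
move=> ro; have [bz1 bz2 [Y1 mY1 q1E] [Y2 mY2 q2E]] := ro.
have bq1 := bounded_measurable_qsym _ mY1.
have bq2 := bounded_measurable_qsym _ mY2.
have bg1 := bounded_measurable_investment_cost _
  (fun w => inv_marginal_cost_ge0 _ Hg _) bq1.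
have bg2 := bounded_measurable_investment_cost _
  (fun w => inv_marginal_cost_ge0 _ Hg _) bq2.
have bC := bounded_measurable_allocation_cost _ ro.
have bA : bounded_measurable (fun w =>
    quality1 o (X1 w) * alloc1 o (X1 w) (X2 w) - g (quality1 o (X1 w))
    + (quality2 o (X2 w) * alloc2 o (X1 w) (X2 w) - g (quality2 o (X2 w)))).
  under eq_fun do rewrite q1E q2E.
  apply: bounded_measurableD; apply: bounded_measurableB => //;
    exact: bounded_measurableM.
have baC := bounded_measurableM _ _ (bounded_measurable_cst a) bC.
have iC := bounded_measurable_integrable P _ bC.
have iA := bounded_measurable_integrable P _ bA.
have iaC := bounded_measurable_integrable P _ baC.
rewrite /expected_surplus /expected_allocation_cost -RintegralZl// -RintegralB//.
rewrite /Rintegral fineK; last first.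
  apply: integrable_fin_num => //.
  by apply: bounded_measurable_integrable; exact: bounded_measurableB.
rewrite /buyer_utility unlock; apply: eq_integral => w _.
by congr EFin; rewrite /buyer_payoff /allocation_cost; ring.
Qed.

(* On {m2 < x1 <= t, s < x2 <= m1} the excess cost J x1 - J x2 is at least
   J m2 - J m1 > 0; separating m1 from m2 makes this bound uniform. *)
Lemma lt_expected_allocation_cost o o' s m1 m2 t :
  regular_outcome o -> regular_outcome o' ->
  0 <= s -> s < m1 -> m1 < m2 -> m2 < t -> t <= 1 ->
  (forall x1 x2, x1 \in `[0, 1] -> x2 \in `[0, 1] ->
     allocation_cost o x1 x2 <= allocation_cost o' x1 x2) ->
  (forall x1 x2, x1 \in `[0, 1] -> x2 \in `[0, 1] ->
     m2 < x1 <= t -> s < x2 <= m1 ->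
     allocation_cost o x1 x2 + (J x1 - J x2) = allocation_cost o' x1 x2) ->
  expected_allocation_cost o < expected_allocation_cost o'.
Proof.
move=> ro ro' s0 sm1 m12 m2t t1 le_o split_o.
have X01 w : X1 w \in `[0, 1] /\ X2 w \in `[0, 1].
  by case: Htypes => /(_ w)/andP.
have m101 : m1 \in `[0, 1] by rewrite in_itv/=; lra.
have m201 : m2 \in `[0, 1] by rewrite in_itv/=; lra.
apply: (@lt_Rintegral _ _ _ P _ _ (J m2 - J m1)
  (X1 @^-1` `]m2, t] `&` X2 @^-1` `]s, m1])).
- exact: bounded_measurable_allocation_cost.
- exact: bounded_measurable_allocation_cost.
- by move=> w; apply: le_o; case: (X01 w).
- by rewrite subr_gt0; exact: HJ.
- by apply: measurableI; rewrite -[X in measurable X]setTI; exact: measurable_funPT.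
- exact: types_split_gt0 Htypes _ _ _ _ s0 sm1 m12 m2t t1.
- move=> w [] /=; rewrite !in_itv/= => x1m2 x2m1.
  have [x101 x201] := X01 w; rewrite -split_o// lerD2l.
  case/andP: x1m2 => /ltW m2x1 _; case/andP: x2m1 => _ x2m1.
  have h1 := virtual_cost_le HJ _ _ m201 x101 m2x1.
  have h2 := virtual_cost_le HJ _ _ x201 m101 x2m1.
  lra.
Qed.

Lemma regular_score_floor t : regular_outcome (score_floor F g t).
Proof.
have bz : bounded_measurable (fun w => ((Num.min t (X1 w) < X2 w)%R)%:R : R).
  apply: bounded_measurable_bool; apply: measurable_fun_ltr => //.
  exact: measurable_minr.
split => //=.
- by apply: bounded_measurableB => //; exact: bounded_measurable_cst.
- by exists (fun w => Num.min t (X1 w)) => //; exact: measurable_minr.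
(* From the threshold on, firm 2 supplies the quality of type 1. *)
- exists (fun w => if X2 w < t then X2 w else 1) => [|w]; last by case: ifP.
  by apply: measurable_fun_ifT => //; exact: measurable_fun_ltr.
Qed.

Lemma regular_score_ceiling t : regular_outcome (score_ceiling F g t).
Proof.
have bz : bounded_measurable (fun w => ((Num.max t (X2 w) < X1 w)%R)%:R : R).
  apply: bounded_measurable_bool; apply: measurable_fun_ltr => //.
  exact: measurable_maxr.
split => //=.
- by apply: bounded_measurableB => //; exact: bounded_measurable_cst.
(* Up to the threshold, firm 1 supplies the quality of type 0. *)
- exists (fun w => if t < X1 w then X1 w else 0) => [|w]; last by case: ifP.
  by apply: measurable_fun_ifT => //; exact: measurable_fun_ltr.
- by exists (fun w => Num.max t (X2 w)) => //; exact: measurable_maxr.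
Qed.

(** The selections differ exactly when [s < x2 <= Num.min t x1]: the floor [s] then selects firm 1,
    the floor [t] firm 2, whose virtual cost is no larger. *)
Lemma score_floor_cost_lt s t : 0 <= s -> s < t -> t <= 1 ->
  expected_allocation_cost (score_floor F g t) <
  expected_allocation_cost (score_floor F g s).
Proof.
move=> s0 st t1.
(* Cutting []s, t]] into thirds puts a gap between the low types of firm 2 and the high types of
   firm 1. *)
pose m1 := s + (t - s) / 3; pose m2 := s + 2 * (t - s) / 3.
have [sm1 m12 m2t] : [/\ s < m1, m1 < m2 & m2 < t] by rewrite /m1 /m2; split; lra.
apply: (lt_expected_allocation_cost _ _ _ _ _ _ (regular_score_floor t)
  (regular_score_floor s) s0 sm1 m12 m2t t1) => x1 x2 x101 x201;
  rewrite /allocation_cost/= !gt_min.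
  have [tx2|tx2] := ltP t x2 => /=; first by rewrite (lt_trans st tx2).
  have [x12|x21] := ltP x1 x2 => /=; first by rewrite orbT.
  rewrite orbF; have [sx2|//] := ltP s x2.
  by have := virtual_cost_le HJ _ _ x201 x101 x21; rewrite /=; lra.
move=> /andP[m2x1 x1t] /andP[sx2 x2m1].
have x21 : x2 <= x1 by apply: ltW; exact: le_lt_trans (lt_trans m12 m2x1).
by rewrite sx2 !ltNge (le_trans x21 x1t) x21 /=; ring.
Qed.

(** The selections differ exactly when [Num.max s x2 < x1 <= t]: the ceiling [s] then selects firm
    2, the ceiling [t] firm 1, whose virtual cost is at least as large. *)
Lemma score_ceiling_cost_lt s t : 0 <= s -> s < t -> t <= 1 ->
  expected_allocation_cost (score_ceiling F g s) <
  expected_allocation_cost (score_ceiling F g t).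
Proof.
move=> s0 st t1.
pose m1 := s + (t - s) / 3; pose m2 := s + 2 * (t - s) / 3.
have [sm1 m12 m2t] : [/\ s < m1, m1 < m2 & m2 < t] by rewrite /m1 /m2; split; lra.
apply: (lt_expected_allocation_cost _ _ _ _ _ _ (regular_score_ceiling s)
  (regular_score_ceiling t) s0 sm1 m12 m2t t1) => x1 x2 x101 x201;
  rewrite /allocation_cost/= !gt_max.
  have [tx1|tx1] := ltP t x1 => /=; first by rewrite (lt_trans st tx1).
  have [x21|x12] := ltP x2 x1 => /=; last by rewrite andbF.
  rewrite andbT; have [sx1|//] := ltP s x1.
  by have := virtual_cost_le HJ _ _ x201 x101 (ltW x21); rewrite /=; lra.
move=> /andP[m2x1 x1t] /andP[sx2 x2m1].
have x21 : x2 < x1 by exact: le_lt_trans (lt_trans m12 m2x1).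
by rewrite (ltNge t) x1t (lt_trans sx2 x21) x21 /=; ring.
Qed.

End mechanism.

(** * Monotonicity of the optimal thresholds in the weight of private information *)

Theorem proposition11 (R : realType) (d : measure_display) (T : measurableType d)
    (P : probability T R) (theta1 theta2 : {RV P >-> R}) (F f g : R -> R)
    (Htypes : iid_types F f theta1 theta2)
    (HJ : {in `[0, 1] &, {homo virtual_cost F f : x y / x < y}})
    (Hg : investment_cost g) :
  (forall a a' t t' : R, 0 < a -> a < a' ->
     optimal_threshold
       (fun s => buyer_utility theta1 theta2 F f g a (score_floor F g s)) t ->
     optimal_threshold
       (fun s => buyer_utility theta1 theta2 F f g a' (score_floor F g s)) t' ->
     t <= t') /\
  (forall a a' t t' : R, 0 < a -> a < a' ->
     optimal_threshold
       (fun s => buyer_utility theta1 theta2 F f g a (score_ceiling F g s)) t ->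
     optimal_threshold
       (fun s => buyer_utility theta1 theta2 F f g a' (score_ceiling F g s)) t' ->
     t' <= t).
Proof.
split => a a' t t' _ aa' ot ot'.
- have := optimal_threshold_le _ _ _ _ _ _ _
    (fun b s => buyer_utilityE Htypes HJ Hg b _ (regular_score_floor s))
    aa' ot ot'.
  case: ot ot' => [+ _] [+ _]; rewrite !in_itv/= => /andP[_ t1] /andP[t'0 _].
  (* If [t' < t], the floor [t'] would have the strictly larger cost. Strictness is what orders
     arbitrary maximizers at [a] and [a']. *)
  apply: contraTT; rewrite -!ltNge => t't.
  exact: score_floor_cost_lt.
- have := optimal_threshold_le _ _ _ _ _ _ _
    (fun b s => buyer_utilityE Htypes HJ Hg b _ (regular_score_ceiling s))
    aa' ot ot'.
  case: ot ot' => [+ _] [+ _]; rewrite !in_itv/= => /andP[t0 _] /andP[_ t'1].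
  apply: contraTT; rewrite -!ltNge => tt'.
  exact: score_ceiling_cost_lt.
Qed.
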